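(* Let $q=p^r$ be a prime power. If an $[n,k,d]_q$ linear code over $\mathbb{F}_q$ exists, then there exists an $[[N,k,d';c]]_q$ EAQECC with $sd-1\ge d'\ge d$ and $(N,c)$ as follows: (i) $(N,c)=(2n-k,\,2n-2k)$ if $q$ is even and $s=2$; (ii) $(N,c)=(3n-2k,\,3n-3k)$ if $q\equiv 1 \pmod 4$ and $s=3$; (iii) $(N,c)=(4n-3k,\,4n-4k)$ if $q\equiv 3\pmod 4$ and $s=4$; (iv) $(N,c)=(5n-4k,\,5n-5k)$ for any $q$ and $s=5$.
   Context: An $[n,k,d]_q$ linear code is a $k$-dimensional subspace of $\mathbb{F}_q^n$ with minimum Hamming distance $d$. An $[[n,k,d;c]]_q$ entanglement-assisted quantum error-correcting code (EAQECC) encodes $k$ logical qudits into $n$ physical qudits using $c$ copies of maximally entangled states pre-shared between sender and receiver. In standard terms: with $\mathcal{H}=\mathbb{C}^q$ and $\Phi=q^{-1/2}\sum_{i}|i\rangle|i\rangle\in\mathcal{H}\otimes\mathcal{H}$, it is a subspace $Q=\{(U\otimes I)(|\psi\rangle\otimes|0\rangle^{\otimes (n-k-c)}\otimes\Phi^{\otimes c}):\psi\in\mathcal{H}^{\otimes k}\}$ of $\mathcal{H}^{\otimes n}\otimes\mathcal{H}^{\otimes c}$, where $U$ is a unitary on the sender's $n$ qudits (the $k$ data qudits, the $n-k-c$ ancillas and the sender's halves of the $c$ pairs) and $I$ acts on the receiver's $c$ halves, such that, with $P$ the orthogonal projector onto $Q$, for every operator $E$ on $\mathcal{H}^{\otimes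 n}$ acting nontrivially on at most $d-1$ qudits there is a scalar $\lambda_E$ with $P(E\otimes I)P=\lambda_E P$. *)

(* Defs.v *)
From mathcomp Require Import all_boot all_order all_algebra all_field.
From mathcomp Require Import reals.
From mathcomp.real_closed Require Import complex mxtens.

Set Implicit Arguments.
Unset Strict Implicit.
Unset Printing Implicit Defensive.

Import Order.TTheory GRing.Theory Num.Theory.
Local Open Scope ring_scope.
Local Open Scope sesquilinear_scope.

Section LinearCodes.

Variable F : finFieldType.

Definition hamming_dist n (u v : 'rV[F]_n) : nat :=
  #|[set i | u 0 i != v 0 i]|.

(* The minimum is required to be attained, so a code of dimension 0 has no
   minimum distance. *)
Definition has_min_dist n (A : {vspace 'rV[F]_n}) (d : nat) : Prop :=
  (exists u v, [/\ u \in A, v \in A, u != v & hamming_dist u v = d])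
  /\ (forall u v, u \in A -> v \in A -> u != v -> (d <= hamming_dist u v)%N).

Definition is_linear_code n k d (A : {vspace 'rV[F]_n}) : Prop :=
  \dim A = k /\ has_min_dist A d.

End LinearCodes.

Section EntanglementAssistedCodes.

Variables (C : numClosedFieldType) (q : nat).

(* The computational basis of n qudits is indexed by the words of length n, so
   H^{(x) n} is the space of column vectors of size #|word n| = q ^ n. *)
Definition word (n : nat) : finType := n.-tuple 'I_q.

Definition ket (T : finType) (x : T) : 'cV[C]_#|T| := delta_mx (enum_rank x) 0.

Definition joint_state (n c : nat) : Type := 'cV[C]_(#|word n| * #|word c|).

Definition tens_state m n (u : 'cV[C]_m) (v : 'cV[C]_n) : 'cV[C]_(m * n) :=
  u *t v.

(* Phi = q^(-1/2) * sum_i |i>|i>. *)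
Definition max_ent : 'cV[C]_(q * q) :=
  (sqrtC q%:R)^-1 *: \sum_(i < q) tens_state (delta_mx i 0) (delta_mx i 0).

Definition max_ent_amp (a b : 'I_q) : C := max_ent (mxtens_index (a, b)) 0.

(* |psi> (x) |0>^{(x) n-k-c} (x) Phi^{(x) c}, with the sender's halves of the
   c pairs moved to the last c of the n qudits in the left tensor factor and
   the receiver's halves to the right one: u is a data word, w and y are the
   words on the sender's and receiver's halves.  The innermost sum has a single
   term when k + c <= n.  Words are compared through their values in nat
   because 'I_q has no canonical 0. *)
Definition initial_state n k c (psi : 'cV[C]_#|word k|) : joint_state n c :=
  \sum_(u : word k) \sum_(w : word c) \sum_(y : word c)
    (psi (enum_rank u) 0 * \prod_(i < c) max_ent_amp (tnth w i) (tnth y i)) *: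
      tens_state
        (\sum_(x : word n | map val x ==
                            map val u ++ nseq (n - k - c) 0%N ++ map val w)
           ket x)
        (ket y).

Definition on_sender n c (A : 'M[C]_#|word n|) :
  'M[C]_(#|word n| * #|word c|) := A *t (1%:M : 'M[C]_#|word c|).

Definition is_encoded_space n k c (Q : {vspace joint_state n c}) : Prop :=
  (k + c <= n)%N /\
  exists2 U : 'M[C]_#|word n|, U \is unitarymx &
    forall v, v \in Q <->
      exists psi : 'cV[C]_#|word k|, v = on_sender c U *m initial_state n c psi.

Definition restrict n (S : {set 'I_n}) (x : word n) :
  {ffun {i | i \in S} -> 'I_q} := [ffun i => tnth x (val i)].

(* E = A (x) I, with A acting on the qudits in S and I on the others. *)
Definition acts_only_on n (S : {set 'I_n}) (E : 'M[C]_#|word n|) : Prop :=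
  exists A : 'M[C]_#|{ffun {i | i \in S} -> 'I_q}|, forall x y : word n,
    E (enum_rank x) (enum_rank y) =
      A (enum_rank (restrict S x)) (enum_rank (restrict S y)) *
      \prod_(i | i \notin S) (tnth x i == tnth y i)%:R.

Definition is_orthogonal_projector m (Q : {vspace 'cV[C]_m}) (P : 'M[C]_m) :
  Prop :=
  [/\ P *m P = P, P^t* = P & forall v, v \in Q <-> exists w, v = P *m w].

Definition is_eaqecc n k d c (Q : {vspace joint_state n c}) : Prop :=
  is_encoded_space k Q /\
  exists2 P, is_orthogonal_projector Q P &
    forall (S : {set 'I_n}) (E : 'M[C]_#|word n|),
      (#|S| < d)%N -> acts_only_on S E ->
      exists lambda : C, P *m on_sender c E *m P = lambda *: P.

(* [is_eaqecc] is downward closed in d, so the distance of a code, to which an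
   upper bound can meaningfully refer, is the largest such d. *)
Definition eaqecc_exists n k d c : Prop :=
  exists2 Q : {vspace joint_state n c},
    is_eaqecc k d Q & forall d1, is_eaqecc k d1 Q -> (d1 <= d)%N.

End EntanglementAssistedCodes.

(* Main.v *)
Require Import Defs.
From mathcomp Require Import all_boot all_order all_algebra all_field.
From mathcomp Require Import fingroup perm zify.
From mathcomp Require Import reals.
From mathcomp.real_closed Require Import complex mxtens.

Set Implicit Arguments.
Unset Strict Implicit.
Unset Printing Implicit Defensive.

Import Order.TTheory GRing.Theory Num.Theory.

(* Let [I | A] be a systematic generator matrix of the given code, and let
   a_1, ..., a_s be scalars, not all zero, whose squares sum to 0, namely (1, 1)
   in even and (1, a, b) in odd characteristic, padded by zeros; in the latter
   case -1 = a^2 + b^2.  Put B = [a_1 A | ... | a_s A].  Then B B^T = 0, the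
   code generated by G = [I | B] has minimum distance D with d <= D <= s d - 1,
   and it meets its dual, generated by H = [-B^T | I],
   trivially.  Hence |u w> |-> |u G + w H> permutes the computational basis;
   applying it to the sender's qudits sends |u> to
   V|u> = q^(-c/2) \sum_w |u G + w H> |w>, and no ancilla is needed.  For an
   error E on the sender's qudits,
     <u'| V^* (E (x) I) V |u> = q^(-c) \sum_w <u' G + w H| E |u G + w H>.
   If E acts on a set S of fewer than D qudits, this vanishes for u' <> u because
   (u' - u) G is not supported in S, and for u' = u it does not depend on u
   because u G agrees on S with some w0 H, which a shift of w absorbs.  The shift
   by a codeword of weight D is not detected, so the distance is exactly D. *)

(** * Sums over basis indices of tensor products *)

Section Indexing.

Local Open Scope ring_scope.

Lemma sum_enum_rank (V : nmodType) (T : finType) (f : 'I_#|T| -> V) :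
  \sum_i f i = \sum_(x : T) f (enum_rank x).
Proof. by rewrite (reindex _ (onW_bij _ (enum_rank_bij T))). Qed.

Lemma sum_mxtens (V : nmodType) m n (f : 'I_(m * n) -> V) :
  \sum_i f i = \sum_i \sum_j f (mxtens_index (i, j)).
Proof.
rewrite pair_big /= (reindex (@mxtens_index m n)) /=.
  by apply: eq_bigr => -[].
by exists (@mxtens_unindex m n) => i _; rewrite (mxtens_indexK, mxtens_unindexK).
Qed.

Lemma sum_pick (V : nmodType) (T : finType) (x : T) (f : T -> V) :
  \sum_y f y *+ (y == x) = f x.
Proof.
rewrite (bigD1 x) //= eqxx big1 ?addr0 // => y /negPf ->.
by rewrite mulr0n.
Qed.

End Indexing.

(** * Embeddings that leave a copy of the label [y] with the receiver *)

Section PairedEmbedding.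

Local Open Scope ring_scope.
Local Open Scope sesquilinear_scope.

Variables (C : numClosedFieldType) (X Y T : finType) (a : C).

(* a * \sum_y |f t y> (x) |y> is the image of |t>. *)
Definition paired_mx (f : T -> Y -> X) : 'M[C]_(#|X| * #|Y|, #|T|) :=
  \matrix_(i, j) (a *+ (enum_val (mxtens_unindex i).1 ==
    f (enum_val j) (enum_val (mxtens_unindex i).2))).

Lemma paired_mxE f x y t :
  paired_mx f (mxtens_index (enum_rank x, enum_rank y)) (enum_rank t) =
  a *+ (x == f t y).
Proof. by rewrite mxE mxtens_indexK /= !enum_rankK. Qed.

Lemma local_paired_mxE f (E : 'M[C]_#|X|) x y t :
  (E *t (1%:M : 'M_#|Y|) *m paired_mx f)
    (mxtens_index (enum_rank x, enum_rank y)) (enum_rank t) =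
  a * E (enum_rank x) (enum_rank (f t y)).
Proof.
rewrite mxE sum_mxtens sum_enum_rank -[RHS](sum_pick _ (fun x' => a * E _ (enum_rank x'))).
apply: eq_bigr => x' _; rewrite sum_enum_rank.
rewrite -[RHS](sum_pick y (fun y' => a * E _ _ *+ (x' == f t y'))).
apply: eq_bigr => y' _; rewrite tensmxE paired_mxE mxE (inj_eq enum_rank_inj).
by rewrite eq_sym mulr_natr mulrnAl mulrnAr [_ * a]mulrC.
Qed.

Lemma paired_mx_perm f (phi : X -> X) (E : 'M[C]_#|X|) :
  (forall x x', E (enum_rank x) (enum_rank x') = (x == phi x')%:R) ->
  E *t (1%:M : 'M_#|Y|) *m paired_mx f = paired_mx (fun t y => phi (f t y)).
Proof.
move=> EE; apply/matrixP => i j; case: (mxtens_indexP i) => x y.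
rewrite -[x]enum_valK -[y]enum_valK -[j]enum_valK local_paired_mxE paired_mxE.
by rewrite EE mulr_natr.
Qed.

(** The error does not touch the receiver's orthonormal labels [y], so cross terms between different
    [y] vanish. *)
Lemma paired_mx_compress f (E : 'M[C]_#|X|) t t' :
  ((paired_mx f)^t* *m (E *t (1%:M : 'M_#|Y|)) *m paired_mx f)
    (enum_rank t) (enum_rank t') =
  \sum_y a^* * a * E (enum_rank (f t y)) (enum_rank (f t' y)).
Proof.
rewrite -mulmxA mxE sum_mxtens exchange_big sum_enum_rank; apply: eq_bigr => y _.
rewrite sum_enum_rank /= -[RHS](sum_pick _ (fun x => a^* * a * E (enum_rank x) _)).
apply: eq_bigr => x _; rewrite local_paired_mxE 2!mxE paired_mxE rmorphMn mulrnAl.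
by rewrite mulrA.
Qed.

Lemma paired_mx_isometry f :
  (forall t t' y, f t y = f t' y -> t = t') -> a^* * a *+ #|Y| = 1 ->
  (paired_mx f)^t* *m paired_mx f = 1%:M.
Proof.
(* Inserting the trivial error makes the Gram matrix an instance of [paired_mx_compress]. *)
move=> f_inj a_norm; have V1 : paired_mx f = 1%:M *t (1%:M : 'M_#|Y|) *m paired_mx f.
  by rewrite (@paired_mx_perm _ id) // => x x'; rewrite mxE (inj_eq enum_rank_inj).
apply/matrixP => u v; rewrite -[u]enum_valK -[v]enum_valK.
rewrite {2}V1 mulmxA paired_mx_compress.
set t := enum_val u; set t' := enum_val v.
rewrite [RHS]mxE (inj_eq enum_rank_inj) -[X in _ = X *+ _]a_norm -sumr_const -sumrMnl.
apply: eq_bigr => y _.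
rewrite mxE (inj_eq enum_rank_inj) mulr_natr; congr (_ *+ _).
by case: (t =P t') => [->|ne]; rewrite ?eqxx //; case: eqP => // /f_inj.
Qed.

End PairedEmbedding.

(** * Image of an isometry and its orthogonal projector *)

Section Isometry.

Local Open Scope ring_scope.
Local Open Scope sesquilinear_scope.

Variables (C : numClosedFieldType) (m l : nat) (V : 'M[C]_(m, l)).
Hypothesis V_isometry : V^t* *m V = 1%:M.

Definition isometry_image : {vspace 'cV[C]_m} :=
  limg (linfun (mulmx V : 'cV_l -> 'cV_m)).

Lemma isometry_imageP v :
  v \in isometry_image <-> exists w : 'cV_l, v = V *m w.
Proof.
split=> [/memv_imgP[w _ ->]|[w ->]]; first by exists w; rewrite lfunE.
by apply/memv_imgP; exists w; rewrite ?memvf ?lfunE.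
Qed.

Lemma isometry_projector : is_orthogonal_projector isometry_image (V *m V^t*).
Proof.
split.
- by rewrite mulmxA -[V *m _ *m V]mulmxA V_isometry mulmx1.
- by rewrite trmx_mul map_mxM trmxCK.
- move=> v; split=> [/isometry_imageP[w ->]|[w ->]].
    by exists (V *m w); rewrite mulmxA -[V *m _ *m V]mulmxA V_isometry mulmx1.
  by apply/isometry_imageP; exists (V^t* *m w); rewrite mulmxA.
Qed.

(** A code comes with some projector [P]; since [P] fixes the columns of [V], the detection
    condition can be read off on [V] alone. *)
Lemma projector_compress P (E : 'M[C]_m) lambda :
  is_orthogonal_projector isometry_image P -> P *m E *m P = lambda *: P ->
  V^t* *m E *m V = lambda%:M.
Proof.
move=> [PP Pt imP] PEP.
have PV : P *m V = V.
  apply/matrixP => i j; have [w colE_P] : exists w, col j V = P *m w.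
    by apply/imP/isometry_imageP; exists (delta_mx j 0); rewrite colE.
  have /colP/(_ i) : col j (P *m V) = col j V.
    by rewrite !colE -mulmxA -colE colE_P mulmxA PP.
  by rewrite mxE [RHS]mxE.
have VP : V^t* *m P = V^t*.
  by rewrite -{2}PV trmx_mul map_mxM Pt.
rewrite -[X in _ *m X = _]PV -{1}VP.
rewrite !mulmxA -[_ *m P *m E]mulmxA -[_ *m _ *m P]mulmxA.
by rewrite PEP -scalemxAr VP -scalemxAl V_isometry scalemx1.
Qed.

End Isometry.

(** * Initial states without ancillas, and encoding by permutations *)

Section MaximalEntanglement.

Local Open Scope ring_scope.
Local Open Scope sesquilinear_scope.

Variables (C : numClosedFieldType) (q : nat).

Lemma max_ent_ampE (a b : 'I_q) :
  max_ent_amp C a b = (sqrtC q%:R)^-1 *+ (a == b).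
Proof.
rewrite /max_ent_amp /max_ent mxE summxE -[RHS]mulr_natr; congr (_ * _).
transitivity (\sum_(i < q) (b == i)%:R *+ (i == a) : C); last first.
  by rewrite sum_pick eq_sym.
apply: eq_bigr => i _; rewrite /tens_state mxE mxtens_indexK /= !mxE.
by rewrite !ord1 !eqxx !andbT [a == i]eq_sym mulr_natl mulrb; case: (i == a).
Qed.

Definition max_ent_norm c : C := (sqrtC q%:R)^-1 ^+ c.

Lemma max_ent_normE c : (0 < q)%N ->
  (max_ent_norm c)^* * max_ent_norm c *+ #|word q c| = 1.
Proof.
move=> q_gt0; rewrite card_tuple card_ord /max_ent_norm.
have sq_ge0 : 0 <= (sqrtC q%:R)^-1 ^+ c :> C.
  by rewrite exprn_ge0 // invr_ge0 sqrtC_ge0 ler0n.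
rewrite (CrealP _) ?ger0_real // -exprMn -expr2 exprVn sqrtCK -mulr_natr natrX.
by rewrite -exprMn mulVf ?expr1n // pnatr_eq0 -lt0n.
Qed.

Lemma prod_max_ent_amp c (w y : word q c) :
  \prod_(i < c) max_ent_amp C (tnth w i) (tnth y i) =
  max_ent_norm c *+ (w == y).
Proof.
case: eqP => [->|/eqP ne].
  under eq_bigr do rewrite max_ent_ampE eqxx.
  by rewrite prodr_const card_ord.
have [i ne_i] : exists i, tnth w i != tnth y i.
  apply/existsP; rewrite -negb_forall; apply: contra ne => /forallP eq_wy.
  by apply/eqP/eq_from_tnth => i; apply/eqP.
by rewrite (bigD1 i) //= max_ent_ampE (negPf ne_i) mul0r.
Qed.

Lemma initial_stateE k c (psi : 'cV[C]_#|word q k|) :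
  initial_state (k + c) c psi =
  paired_mx (max_ent_norm c) (fun u y => cat_tuple u y) *m psi.
Proof.
apply/matrixP => i j; case: (mxtens_indexP i) => x y.
rewrite -[x]enum_valK -[y]enum_valK [j]ord1.
set x' := enum_val x; set y' := enum_val y.
rewrite /initial_state summxE [RHS]mxE sum_enum_rank; apply: eq_bigr => u _.
rewrite summxE paired_mxE.
rewrite -[RHS](sum_pick y' (fun w => max_ent_norm c *+ (x' == cat_tuple u w) * _)).
apply: eq_bigr => w _; rewrite summxE.
rewrite -[RHS](sum_pick y' (fun y => _ *+ (w == y))).
apply: eq_bigr => y'' _; rewrite mxE prod_max_ent_amp /tens_state.
rewrite !mxE mxtens_indexK /= !ord1 summxE.
(* For length [k + c] the block of zeros is empty, so the only matching word is the
   concatenation. *)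
rewrite (eq_bigl (pred1 (cat_tuple u w))) ?big_pred1_eq; last first.
  move=> z /=; rewrite addKn subnn /= -map_cat (inj_eq (inj_map val_inj)).
  by rewrite -(inj_eq val_inj).
rewrite !mxE !andbT !(inj_eq enum_rank_inj) [y' == _]eq_sym.
by do 3!case: (_ == _); rewrite ?(mulr1, mulr0n, mulr1n, mul0r, mulr0) // mulrC.
Qed.

(** The encoding unitary is the permutation matrix of [phi], which merely relabels the sender's
    basis words. *)
Lemma paired_encoded_space k c (phi : {perm word q (k + c)}) : (0 < q)%N ->
  is_encoded_space k (isometry_image
    (paired_mx (max_ent_norm c) (fun u y => phi (cat_tuple u y)))).
Proof.
move=> q_gt0; split=> //.
pose U : 'M[C]_#|word q (k + c)| := \matrix_(r, s) (enum_val r == phi (enum_val s))%:R.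
exists U => [|v].
  apply/unitarymxP/matrixP => r s; rewrite -[r]enum_valK -[s]enum_valK.
  set x := enum_val r; set y := enum_val s.
  rewrite mxE sum_enum_rank (reindex_inj (@perm_inj _ phi^-1%g)).
  rewrite [RHS]mxE (inj_eq enum_rank_inj) eq_sym.
  rewrite -[RHS](sum_pick x (fun z => (y == z)%:R)).
  apply: eq_bigr => z _; rewrite !mxE !enum_rankK permKV rmorph_nat.
  by rewrite mulr_natl [x == z]eq_sym.
have UE x x' : U (enum_rank x) (enum_rank x') = (x == phi x')%:R.
  by rewrite mxE !enum_rankK.
split=> [/isometry_imageP[psi ->]|[psi ->]].
  by exists psi; rewrite initial_stateE mulmxA /on_sender (paired_mx_perm _ _ UE).
apply/isometry_imageP; exists psi.
by rewrite initial_stateE mulmxA /on_sender (paired_mx_perm _ _ UE).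
Qed.

(** Such an operator is a tensor product of one-qudit operators, trivial outside [S]. It serves for
    shifts by a codeword. *)
Lemma acts_only_on_coordinatewise n (S : {set 'I_n}) (g : 'I_n -> 'I_q -> 'I_q) :
  (forall i, i \notin S -> g i =1 id) ->
  acts_only_on S (\matrix_(r, s)
    (enum_val r == [tuple g i (tnth (enum_val s) i) | i < n])%:R : 'M[C]_#|word q n|).
Proof.
move=> g_id; exists (\matrix_(r, s) (enum_val r ==
  [ffun i => g (val i) ((enum_val s : {ffun _ -> _}) i)])%:R) => x y.
rewrite !mxE !enum_rankK; case: eqP => [->|/eqP ne].
  rewrite big1 => [|i iS]; last by rewrite tnth_mktuple g_id ?eqxx.
  rewrite mulr1; case: eqP => // -[]; apply/ffunP => i.
  by rewrite !ffunE tnth_mktuple.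
have [i ne_i] : exists i, tnth x i != g i (tnth y i).
  apply/existsP; rewrite -negb_forall; apply: contra ne => /forallP eq_xy.
  by apply/eqP/eq_from_tnth => i; rewrite tnth_mktuple; apply/eqP.
have [iS|iS] := boolP (i \in S); last first.
  by rewrite (bigD1 i) //= -{1}(g_id i iS (tnth y i)) (negPf ne_i) mul0r mulr0.
case: eqP => [/ffunP/(_ (Sub i iS))|]; rewrite ?mul0r // !ffunE /=.
by move/eqP; rewrite (negPf ne_i).
Qed.

(** * Criteria for detecting and for missing an error *)

Section KnillLaflamme.

Variables (k c n : nat) (f : word q k -> word q c -> word q n).

Let V : 'M[C]_(_, _) := paired_mx (max_ent_norm c) f.

(** Off-diagonal entries vanish because the two words differ where [E] is the identity. A diagonal
    entry of [E] depends only on the letters in [S], so reindexing by [h] makes the sum independent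
    of [u]. *)
Lemma paired_detects (S : {set 'I_n}) (E : 'M[C]_#|word q n|) :
  acts_only_on S E ->
  (forall u u' y, u != u' ->
     exists2 i, i \notin S & tnth (f u y) i != tnth (f u' y) i) ->
  (forall u u', exists2 h : word q c -> word q c, injective h &
     forall y i, i \in S -> tnth (f u y) i = tnth (f u' (h y)) i) ->
  exists lambda, V^t* *m on_sender c E *m V = lambda%:M.
Proof.
move=> [A EA] off_S on_S.
(* If there are no data words, the matrix is empty and any scalar serves; otherwise the diagonal
   entry at [u0] is the scalar. *)
have [u0 _|no_u] := pickP (@predT (word q k)); last first.
  by exists 0; apply/matrixP => r s; have := no_u (enum_val r).
exists (\sum_y (max_ent_norm c)^* * max_ent_norm c *
  E (enum_rank (f u0 y)) (enum_rank (f u0 y))).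
apply/matrixP => r s; rewrite -[r]enum_valK -[s]enum_valK paired_mx_compress.
set u := enum_val r; set u' := enum_val s; rewrite [RHS]mxE (inj_eq enum_rank_inj).
case: (eqVneq u u') => [<-|ne]; last first.
  rewrite big1 // => y _; have [i iS ne_i] := off_S u u' y ne.
  by rewrite EA (bigD1 i) //= (negPf ne_i) mul0r !mulr0.
have [h h_inj fh] := on_S u u0.
rewrite [RHS](reindex_inj h_inj); apply: eq_bigr => y _; congr (_ * _).
rewrite !EA !big1 => [|i _|i _]; rewrite ?eqxx //.
suff -> : Defs.restrict S (f u y) = Defs.restrict S (f u0 (h y)) by [].
by apply/ffunP => i; rewrite !ffunE fh ?(valP i).
Qed.

(** The error carries the encoding of [u'] exactly onto that of [u], which gives an off-diagonal
    entry 1. *)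
Lemma paired_not_detects (g : word q n -> word q n) (E : 'M[C]_#|word q n|) u u' :
  (0 < q)%N -> (forall x x', E (enum_rank x) (enum_rank x') = (x == g x')%:R) ->
  u != u' -> (forall y, f u y = g (f u' y)) ->
  ~ exists lambda, V^t* *m on_sender c E *m V = lambda%:M.
Proof.
move=> q_gt0 EE ne fg [lambda /matrixP/(_ (enum_rank u) (enum_rank u'))].
rewrite paired_mx_compress mxE (inj_eq enum_rank_inj) (negPf ne).
under eq_bigr do rewrite EE -fg eqxx mulr1.
by rewrite sumr_const max_ent_normE // => /eqP; rewrite oner_eq0.
Qed.

End KnillLaflamme.

End MaximalEntanglement.

(** * Hamming weight *)

Section Weight.

Local Open Scope ring_scope.

Definition weight (F : nzRingType) n (v : 'rV[F]_n) : nat :=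
  #|[set i | v 0 i != 0]|.

Lemma hamming_dist_weight (F : finFieldType) n (u v : 'rV[F]_n) :
  hamming_dist u v = weight (u - v).
Proof. by apply: eq_card => i; rewrite !inE !mxE subr_eq0. Qed.

Lemma weight_sum (F : nzRingType) n (v : 'rV[F]_n) :
  weight v = (\sum_i (v 0 i != 0)%R)%N.
Proof.
rewrite /weight -sum1_card big_mkcond /=; apply: eq_bigr => i _.
by rewrite inE; case: eqP.
Qed.

Lemma weight_row_mx (F : nzRingType) m n (u : 'rV[F]_m) (v : 'rV[F]_n) :
  weight (row_mx u v) = (weight u + weight v)%N.
Proof.
rewrite !weight_sum big_split_ord /=.
by congr (_ + _)%N; apply: eq_bigr => i _; rewrite (row_mxEl, row_mxEr).
Qed.

Lemma weight_eq0 (F : nzRingType) n (v : 'rV[F]_n) : (weight v == 0%N) = (v == 0).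
Proof.
rewrite cards_eq0; apply/eqP/eqP => [/setP v0|->].
  by apply/rowP => i; have := v0 i; rewrite !inE !mxE => /negbFE/eqP.
by apply/setP => i; rewrite !inE !mxE eqxx.
Qed.

End Weight.

(** * A systematic code and its dual *)

Section Code.

Local Open Scope ring_scope.

Variables (F : finFieldType) (k c : nat) (B : 'M[F]_(k, c)).

Let G : 'M_(k, k + c) := row_mx 1%:M B.
Let H : 'M_(c, k + c) := row_mx (- B^T) 1%:M.

Lemma mul_systematic (x : 'rV_k) : x *m G = row_mx x (x *m B).
Proof. by rewrite mul_mx_row mulmx1. Qed.

(* The rows of H span the orthogonal of the code, so their restriction to S is
   full rank as soon as no codeword is supported in S. *)
Lemma dual_interpolation (S : {set 'I_(k + c)}) (v : 'rV_(k + c)) :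
  (forall x : 'rV_k, x != 0 -> (#|S| < weight (x *m G))%N) ->
  exists w : 'rV_c, forall i, i \in S -> v 0 i = (w *m H) 0 i.
Proof.
(* [J] erases the coordinates outside [S]. *)
move=> S_small; pose J : 'M[F]_(k + c) := diag_mx (\row_i (i \in S)%:R).
have JE m (M : 'M_(m, k + c)) a i : (M *m J) a i = M a i * (i \in S)%:R.
  by rewrite /J mul_mx_diag !mxE.
suff /submxP[w vJ] : (v *m J <= H *m J)%MS.
  exists w => i iS; have := congr1 (fun M : 'rV_(k + c) => M 0 i) vJ.
  by rewrite mulmxA !JE iS !mulr1.
rewrite submxE -mulmxA; apply/eqP; set Y := J *m _.
suff -> : Y = 0 by rewrite mulmx0.
have HY : H *m Y = 0 by rewrite mulmxA mulmx_coker.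
(* The columns of [Y] are orthogonal to the rows of [H], hence are codewords, determined by their
   first [k] entries. *)
have YE : Y = G^T *m usubmx Y.
  rewrite -[LHS]vsubmxK tr_row_mx mul_col_mx trmx1 mul1mx; congr col_mx.
  move: HY; rewrite -[Y in _ *m Y]vsubmxK mul_row_col mul1mx mulNmx.
  by rewrite addrC => /subr0_eq.
apply/matrixP => i j; rewrite mxE; pose x := (col j (usubmx Y))^T.
have xG : x *m G = (col j Y)^T by rewrite [in RHS]YE /x !colE -mulmxA [in RHS]trmx_mul trmxK.
suff x0 : x = 0.
  have := congr1 (fun M : 'rV_(k + c) => M 0 i) xG.
  by rewrite x0 mul0mx !mxE.
(* The factor [J] confines this codeword to [S], which a nonzero codeword is too heavy for. *)
apply/eqP; apply: contraT => /S_small; rewrite ltnNge subset_leq_card //.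
apply/subsetP => l; rewrite inE xG mxE [col j Y l 0]mxE; apply: contraNT => lS.
by rewrite /Y /J mul_diag_mx !mxE (negPf lS) mul0r.
Qed.

Hypothesis B_isotropic : B *m B^T = 0.

(* Explicit inverse: K K^T = diag (1, 1 + B^T B), and (B^T B)^2 = 0. *)
Lemma code_dual_unit : col_mx G H \in unitmx.
Proof.
set K := col_mx G H.
suff : K *m (K^T *m block_mx 1%:M 0 0 (1%:M - B^T *m B)) = 1%:M.
  by case/mulmx1_unit.
rewrite mulmxA tr_col_mx mul_col_row !tr_row_mx !mul_row_col !trmx1 !mulmx1 !mul1mx.
have -> : (- B^T)^T = - B by rewrite linearN /= trmxK.
rewrite B_isotropic addr0 !addNr mulmxN mulNmx opprK.
rewrite mulmx_block !mul1mx !mulmx0 !mul0mx !addr0 !add0r.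
have BB0 : B^T *m B *m (B^T *m B) = 0.
  by rewrite mulmxA -[_ *m B *m B^T]mulmxA B_isotropic mulmx0 mul0mx.
rewrite mulmxBr mulmx1 mulmxDl mul1mx BB0 add0r addrAC subrr add0r.
by rewrite -scalar_mx_block.
Qed.

End Code.

(** * From vectors over the field to basis words: the quantum code and its exact distance *)

Section Words.

Local Open Scope ring_scope.
Local Open Scope sesquilinear_scope.

Variables (F : finFieldType).

Let q := #|F|.

Definition vec_of_word n (x : word q n) : 'rV[F]_n := \row_i enum_val (tnth x i).

Definition word_of_vec n (v : 'rV[F]_n) : word q n :=
  [tuple enum_rank (v 0 i) | i < n].

Lemma vec_of_wordK n : cancel (@vec_of_word n) (@word_of_vec n).
Proof.
by move=> x; apply: eq_from_tnth => i; rewrite tnth_mktuple mxE enum_valK.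
Qed.

Lemma word_of_vecK n : cancel (@word_of_vec n) (@vec_of_word n).
Proof. by move=> v; apply/rowP => i; rewrite mxE tnth_mktuple enum_rankK. Qed.

Lemma vec_of_word_cat m n (u : word q m) (w : word q n) :
  vec_of_word (cat_tuple u w) = row_mx (vec_of_word u) (vec_of_word w).
Proof.
apply/rowP => i; rewrite mxE -(splitK i); case: (split i) => j /=.
  by rewrite row_mxEl mxE tnth_lshift.
by rewrite row_mxEr mxE tnth_rshift.
Qed.

Variables (k c : nat) (B : 'M[F]_(k, c)).

Hypothesis B_isotropic : B *m B^T = 0.

Let G : 'M_(k, k + c) := row_mx 1%:M B.
Let H : 'M_(c, k + c) := row_mx (- B^T) 1%:M.

Definition encode_word (x : word q (k + c)) : word q (k + c) :=
  word_of_vec (vec_of_word x *m col_mx G H).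

Lemma encode_word_inj : injective encode_word.
Proof.
move=> x y /(can_inj (@word_of_vecK _)) /(can_inj (mulmxK (code_dual_unit B_isotropic))).
exact: (can_inj (@vec_of_wordK _)).
Qed.

Let f u y := perm encode_word_inj (cat_tuple u y).

Lemma encode_wordE (u : word q k) (w : word q c) :
  f u w = word_of_vec (vec_of_word u *m G + vec_of_word w *m H).
Proof. by rewrite /f permE /encode_word vec_of_word_cat mul_row_col. Qed.

Theorem maximal_entanglement_eaqecc (C : numClosedFieldType) D :
  (exists2 x : 'rV_k, x != 0 & weight (row_mx x (x *m B)) = D) ->
  (forall x : 'rV_k, x != 0 -> (D <= weight (row_mx x (x *m B)))%N) ->
  eaqecc_exists C q (k + c) k D c.
Proof.
move=> [x x_neq0 wt_x] minD.
have q_gt0 : (0 < q)%N by rewrite /q; apply/card_gt0P; exists 0.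
set V := paired_mx (max_ent_norm C q c) f.
have V_iso : V^t* *m V = 1%:M.
  apply: paired_mx_isometry => [u u' y|]; last exact: max_ent_normE.
  move=> /perm_inj/(congr1 val)/eqP; rewrite /= eqseq_cat ?size_tuple //.
  by case/andP => /eqP /val_inj.
exists (isometry_image V); last first.
  move=> d1 [_ [P projP detP]]; rewrite leqNgt; apply/negP => D_lt.
  (* The undetected error adds the minimum-weight codeword [x *m G]; it takes the encoding of 0 to
     that of [x] for every [y]. *)
  pose g i (b : 'I_q) : 'I_q := enum_rank (enum_val b + (x *m G) 0 i).
  pose S := [set i | (x *m G) 0 i != 0].
  have [||lambda PEP] := detP S (\matrix_(r, s)
    (enum_val r == [tuple g i (tnth (enum_val s) i) | i < k + c])%:R).
  - by rewrite -[#|S|]/(weight _) mul_systematic wt_x.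
  - apply: acts_only_on_coordinatewise => i; rewrite inE negbK => /eqP xG0 b.
    by rewrite /g xG0 addr0 enum_valK.
  have EV := projector_compress V_iso projP PEP.
  apply: (@paired_not_detects C q k c _ f (fun s => [tuple g i (tnth s i) | i < k + c])
    _ (word_of_vec x) (word_of_vec 0) q_gt0 _ _ _ (ex_intro _ lambda EV)).
  - by move=> z z'; rewrite mxE !enum_rankK.
  - by rewrite (can_eq (@word_of_vecK _)).
  - move=> y; apply: eq_from_tnth => i; rewrite !encode_wordE !word_of_vecK.
    by rewrite !tnth_mktuple /g enum_rankK mul0mx add0r mxE addrC.
split; first exact: paired_encoded_space.
exists (V *m V^t*) => [|S E S_lt E_S]; first exact: isometry_projector.
have [||lambda EV] := @paired_detects C q k c _ f S E E_S.
(* The two encodings differ by the nonzero codeword [z *m G], whose support cannot fit in [S]. *)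
- move=> u u' y ne; pose z := vec_of_word u - vec_of_word u'.
  have z_neq0 : z != 0 by rewrite subr_eq0 (can_eq (@vec_of_wordK _)).
  have /subsetPn[l] : ~~ ([set i | (z *m G) 0 i != 0] \subset S).
    apply/negP => /subset_leq_card; apply/negP; rewrite -ltnNge.
    by apply: leq_trans S_lt _; rewrite -[#|_|]/(weight _) mul_systematic minD.
  rewrite inE => zG lS; exists l => //; apply: contraNN zG.
  rewrite !encode_wordE !tnth_mktuple (inj_eq enum_rank_inj) /z mulmxBl.
  move: (_ *m G) (_ *m G) (_ *m H) => a b e.
  by rewrite !mxE (inj_eq (addIr _)) subr_eq0.
(* On [S] the difference of the encodings equals a dual word [w *m H], so translation by [w] is the
   required [h]. *)
- move=> u u'; have [z zx0|w wH] := @dual_interpolation F k c B S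
    ((vec_of_word u - vec_of_word u') *m G).
    by rewrite mul_systematic; apply: leq_trans S_lt (minD _ _).
  exists (fun y => word_of_vec (vec_of_word y + w)).
    by move=> y y' /(can_inj (@word_of_vecK _))/addIr/(can_inj (@vec_of_wordK _)).
  move=> y i /wH; rewrite !encode_wordE !tnth_mktuple word_of_vecK -/H.
  rewrite mulmxBl mulmxDl.
  move: (_ *m G) (_ *m G) (_ *m H) (_ *m H) => a b d e; rewrite !mxE => <-.
  by congr enum_rank; rewrite [RHS]addrCA [X in _ = _ + X]addrC subrK addrC.
exists lambda; rewrite mulmxA -[V *m _ *m _]mulmxA -[V *m _ *m V]mulmxA EV.
by rewrite mul_mx_scalar -scalemxAl.
Qed.

End Words.

(** * Systematic form of a linear code *)

Section SystematicForm.

Local Open Scope ring_scope.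

Variable F : finFieldType.

Lemma generator_matrix n (A : {vspace 'rV[F]_n}) :
  exists2 g : 'M[F]_(\dim A, n), row_free g &
    forall v, (v \in A) <-> (exists x, v = x *m g).
Proof.
pose g : 'M[F]_(\dim A, n) := \matrix_i (vbasis A)`_i.
have gE (x : 'rV_(\dim A)) : x *m g = \sum_i x 0 i *: (vbasis A)`_i.
  by rewrite mulmx_sum_row; apply: eq_bigr => i _; rewrite rowK.
exists g => [|v].
  apply: inj_row_free => x; rewrite gE => xg0.
  have /freeP := basis_free (vbasisP A).
  by move/(_ _ xg0) => x0; apply/rowP => i; rewrite x0 mxE.
split=> [/coord_vbasis ->|[x ->]].
  exists (\row_i coord (vbasis A) i v); rewrite gE.
  by apply: eq_bigr => i _; rewrite mxE.
rewrite gE; apply: memv_suml => i _; apply/memvZ/vbasis_mem/mem_nth.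
by rewrite size_tuple.
Qed.

(** Inverting [k] independent columns turns them into an identity block. Comparing only weights
    avoids an explicit permutation of the coordinates. *)
Lemma systematic_columns k n (g : 'M[F]_(k, n)) : row_free g ->
  exists m (L : 'M[F]_k) (M : 'M[F]_(k, m)),
    [/\ n = (k + m)%N, L \in unitmx &
      forall x : 'rV_k, weight (x *m L *m g) = weight (row_mx x (x *m M))].
Proof.
move=> g_free.
have gT_full : row_full g^T by rewrite /row_full mxrank_tr.
pose phi := fullrankfun gT_full.
have phi_inj : injective phi by apply: fullrankfun_inj.
pose L := colsub phi g.
have L_unit : L \in unitmx.
  by rewrite -unitmx_tr trmx_mxsub fullrowsub_unit.
(* [J] is an information set; [psi] lists the remaining columns. *)
pose J := phi @: setT; pose psi (j : 'I_#|~: J|) : 'I_n := enum_val j.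
exists #|~: J|, (invmx L), (colsub psi (invmx L *m g)); split.
- by rewrite -{1}(card_ord k) -cardsT -(card_imset setT phi_inj) cardsC card_ord.
- by rewrite unitmx_inv.
move=> x; rewrite weight_row_mx !weight_sum (bigID (mem J)) /=.
congr (_ + _)%N.
  rewrite big_imset /=; last by move=> ? ? _ _; apply: phi_inj.
  rewrite big_mkcond; apply: eq_bigr => j _; rewrite inE.
  suff -> : (x *m invmx L *m g) 0 (phi j) = (x *m invmx L *m L) 0 j by rewrite mulmxKV.
  by rewrite mxE [RHS]mxE; apply: eq_bigr => l _; rewrite [L l j]mxE.
transitivity (\sum_(i in ~: J) ((x *m invmx L *m g) 0 i != 0)%R)%N.
  by apply: eq_bigl => i; rewrite inE.
rewrite big_enum_val; apply: eq_bigr => j _; rewrite -mulmxA.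
suff -> : (x *m (invmx L *m g)) 0 (enum_val j) =
          (x *m colsub psi (invmx L *m g)) 0 j by [].
by rewrite mxE [RHS]mxE; apply: eq_bigr => l _; rewrite [colsub _ _ _ _]mxE.
Qed.

Lemma linear_code_systematic n k d (A : {vspace 'rV[F]_n}) :
  is_linear_code k d A ->
  exists m (M : 'M[F]_(k, m)),
    [/\ n = (k + m)%N,
      exists2 x : 'rV_k, x != 0 & weight (row_mx x (x *m M)) = d &
      forall x : 'rV_k, x != 0 -> (d <= weight (row_mx x (x *m M)))%N].
Proof.
case=> <- [[u [v [uA vA ne uv_d]] min_d]].
have [g g_free gA] := generator_matrix A.
have [m [L [M [n_eq L_unit wtM]]]] := systematic_columns g_free.
have Lg0 (x : 'rV_(\dim A)) : (x *m L *m g == 0) = (x == 0).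
  apply/eqP/eqP => [xLg|->]; last by rewrite !mul0mx.
  apply: (can_inj (mulmxK L_unit)); apply: (row_free_inj g_free).
  by rewrite xLg !mul0mx.
exists m, M; split=> // [|x x_neq0].
  have /gA[x uvE] : u - v \in A by apply: rpredB.
  exists (x *m invmx L); last first.
    by rewrite -wtM mulmxKV // -uvE -hamming_dist_weight.
  by rewrite -Lg0 mulmxKV // -uvE subr_eq0.
rewrite -wtM -[x *m L *m g]subr0 -hamming_dist_weight min_d ?mem0v ?Lg0 //.
by apply/gA; exists (x *m L).
Qed.

End SystematicForm.

(** * Scaled repetition of the redundancy *)

Section Repetition.

Local Open Scope ring_scope.

Variables (F : finFieldType) (k m s : nat) (a : 'I_s -> F) (M : 'M[F]_(k, m)).

(** The Kronecker product of the row [a] with [M]: the scaled copies of [M] stand side by side. *)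
Definition repeat_mx : 'M[F]_(k, s * m) :=
  \matrix_(i, l) (a (mxtens_unindex l).1 * M i (mxtens_unindex l).2).

(** The product is [M *m M^T] scaled by the sum of squares. *)
Lemma repeat_mx_isotropic : \sum_t a t ^+ 2 = 0 -> repeat_mx *m repeat_mx^T = 0.
Proof.
move=> a_isotropic; apply/matrixP => i j; rewrite !mxE sum_mxtens.
transitivity (\sum_t a t ^+ 2 * (M *m M^T) i j); last first.
  by rewrite -mulr_suml a_isotropic mul0r.
apply: eq_bigr => t _; rewrite mxE mulr_sumr; apply: eq_bigr => l _.
by rewrite !mxE mxtens_indexK /= mulrACA.
Qed.

Lemma weight_repeat_mx (x : 'rV_k) :
  weight (x *m repeat_mx) = (\sum_(t < s) (a t != 0)%R * weight (x *m M))%N.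
Proof.
rewrite !weight_sum sum_mxtens; apply: eq_bigr => t _; rewrite big_distrr /=.
apply: eq_bigr => l _; rewrite mulnb -negb_or -mulf_eq0 mxE [(x *m M) _ _]mxE.
rewrite mulr_sumr; congr (nat_of_bool (_ != _)); apply: eq_bigr => i _.
by rewrite mxE mxtens_indexK /= mulrCA.
Qed.

Lemma weight_repeat_le (x : 'rV_k) :
  (weight (x *m repeat_mx) <= s * weight (x *m M))%N.
Proof.
rewrite weight_repeat_mx -[s in (s * _)%N]card_ord -sum_nat_const leq_sum // => t _.
by case: (a t != 0); rewrite ?mul1n.
Qed.

Lemma weight_repeat_ge t (x : 'rV_k) :
  a t != 0 -> (weight (x *m M) <= weight (x *m repeat_mx))%N.
Proof.
by move=> at0; rewrite weight_repeat_mx (bigD1 t) //= at0 mul1n leq_addr.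
Qed.

End Repetition.

(** * Distance bounds and isotropic coefficients *)

Section Existence.

Local Open Scope ring_scope.

Lemma repeated_code_eaqecc (C : numClosedFieldType) (F : finFieldType) n k d s
    (A : {vspace 'rV[F]_n}) (a : 'I_s -> F) t :
  (1 < s)%N -> is_linear_code k d A -> a t != 0 -> \sum_u a u ^+ 2 = 0 ->
  exists2 d', (d <= d' <= s * d - 1)%N &
    eaqecc_exists C #|F| (s * n - s.-1 * k) k d' (s * n - s * k).
Proof.
move=> s_gt1 /linear_code_systematic[m [M [-> [x0 x0_neq0 wt_x0] minM]]] at0 a_iso.
have -> : (s * (k + m) - s.-1 * k = k + s * m)%N by case: s s_gt1 {a t at0 a_iso} => // s' _; nia.
have -> : (s * (k + m) - s * k = s * m)%N by rewrite mulnDr addKn.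
pose wt (x : 'rV_k) := weight (row_mx x (x *m repeat_mx a M)).
(* The distance [d'] is the minimum weight of the code extended by repetition. *)
case: (arg_minnP (P := fun x => x != 0) wt x0_neq0) => x x_neq0 min_x.
exists (wt x); last first.
  apply: (maximal_entanglement_eaqecc (repeat_mx_isotropic M a_iso)) => //.
  by exists x.
apply/andP; split.
  apply: leq_trans (minM x x_neq0) _.
  by rewrite /wt !weight_row_mx leq_add2l (weight_repeat_ge M x at0).
apply: leq_trans (min_x x0 x0_neq0) _.
rewrite /wt weight_row_mx -wt_x0 weight_row_mx.
(* With [w >= 1] the weight of [x0] and [v] that of [x0 *m M], the bound is
   [w + s * v <= s * (w + v) - 1], as [(s - 1) * w >= 1]. *)
have := weight_repeat_le a M x0; move: x0_neq0; rewrite -weight_eq0.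
by move: (weight x0) (weight (x0 *m M)) (weight _) => w v b; nia.
Qed.

(** Pigeonhole: the set [Q] of squares and the set of all [z - y] with [y] in [Q] each contain more
    than half of the field, so they meet. *)
Lemma sum_two_squares (F : finFieldType) (z : F) : odd #|F| ->
  exists a b, a ^+ 2 + b ^+ 2 = z.
Proof.
move=> odd_F; pose Q := [set x ^+ 2 | x : F].
have card_Q : (#|F| < 2 * #|Q|)%N.
  (* Squaring is at most two-to-one; the inequality is strict because [#|F|] is odd. *)
  suff : (#|F| <= #|Q| * 2)%N by lia.
  rewrite -[#|F|]sum1_card (partition_big (fun x : F => x ^+ 2) (mem Q)) /=; last first.
    by move=> x _; apply/imsetP; exists x.
  rewrite -sum_nat_const leq_sum // => _ /imsetP[x _ ->].
  rewrite sum1dep_card; apply: leq_trans (_ : #|[set x; - x]| <= _)%N.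
    by apply/subset_leq_card/subsetP => y; rewrite !inE eqf_sqr.
  by rewrite cards2; case: (_ != _).
have zB_inj : injective (fun y : F => z - y) by move=> x y /addrI/oppr_inj.
have : ~~ [disjoint Q & [set z - y | y in Q]].
  rewrite disjoints_subset; apply: contraL card_Q => /subset_leq_card leQ.
  rewrite -leqNgt mul2n -addnn -(cardsC [set z - y | y in Q]).
  rewrite (card_imset (mem Q) zB_inj).
  by rewrite leq_add2l.
move/pred0Pn => [_ /andP[/imsetP[a _ ->] /imsetP[_ /imsetP[b _ ->] a_eq]]].
by exists a, b; rewrite a_eq subrK.
Qed.

End Existence.

Theorem theorem5p5 (R : realType) (p r q : nat) (F : finFieldType)
    (n k d : nat)
    (p_prime : prime p) (r_gt0 : 0 < r) (q_def : q = p ^ r)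
    (card_F : #|F| = q)
    (code_exists : exists A : {vspace 'rV[F]_n}, is_linear_code k d A) :
  [/\ ~~ odd q ->
        exists2 d', d <= d' <= 2 * d - 1 &
          eaqecc_exists R[i] q (2 * n - k) k d' (2 * n - 2 * k),
      q = 1 %[mod 4] ->
        exists2 d', d <= d' <= 3 * d - 1 &
          eaqecc_exists R[i] q (3 * n - 2 * k) k d' (3 * n - 3 * k),
      q = 3 %[mod 4] ->
        exists2 d', d <= d' <= 4 * d - 1 &
          eaqecc_exists R[i] q (4 * n - 3 * k) k d' (4 * n - 4 * k)
    & exists2 d', d <= d' <= 5 * d - 1 &
        eaqecc_exists R[i] q (5 * n - 4 * k) k d' (5 * n - 5 * k)].
Proof.
case: code_exists => A codeA.
have even_isotropic : ~~ odd q -> (1 + 1 = 0 :> F)%R.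
  rewrite q_def oddX negb_or -lt0n r_gt0 /= => even_p.
  have p2 : p = 2 by case/even_prime: p_prime even_p => // ->.
  have /andP[_ /eqP] : 2 \in [pchar F]%R.
    by apply: (@card_finPcharP _ _ r) => //; rewrite card_F q_def p2.
  by rewrite mulr2n.
have odd_isotropic : odd q -> exists a b : F, (1 + (a ^+ 2 + b ^+ 2) = 0)%R.
  rewrite -card_F => /(sum_two_squares (- 1)%R)[a [b ab]].
  by exists a, b; rewrite ab subrr.
(* Beyond the end of [l] the default value 0 of [nth] pads the coefficients. *)
pose coef s (l : seq F) (t : 'I_s) : F := (l`_t)%R.
have code s (l : seq F) : (\sum_(t < s.+2) coef s.+2 l t ^+ 2 = 0)%R ->
    (l`_0 != 0)%R -> exists2 d', d <= d' <= s.+2 * d - 1 &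
      eaqecc_exists R[i] q (s.+2 * n - s.+1 * k) k d' (s.+2 * n - s.+2 * k).
  move=> l_iso l0; rewrite -card_F.
  apply: (@repeated_code_eaqecc _ F n k d s.+2 A (coef s.+2 l) ord0) => //.
split.
- move=> /even_isotropic e; rewrite -{1}[k]mul1n.
  apply: (code 0 [:: 1; 1]%R); last exact: oner_neq0.
  by rewrite !big_ord_recl big_ord0 /coef /= !expr1n addr0.
- move=> q1; have [|a [b e]] := odd_isotropic; first by lia.
  apply: (code 1 [:: 1; a; b]%R); last exact: oner_neq0.
  by rewrite !big_ord_recl big_ord0 /coef /= !expr1n addr0.
- move=> q3; have [|a [b e]] := odd_isotropic; first by lia.
  apply: (code 2 [:: 1; a; b]%R); last exact: oner_neq0.
  by rewrite !big_ord_recl big_ord0 /coef /= !expr1n expr0n /= !addr0.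
(* Five coefficients accommodate either parity: [1, a, b] or [1, 1], followed by zeros. *)
have [/odd_isotropic[a [b e]]|/even_isotropic e] := boolP (odd q).
  apply: (code 3 [:: 1; a; b]%R); last exact: oner_neq0.
  by rewrite !big_ord_recl big_ord0 /coef /= !expr1n expr0n /= !addr0.
apply: (code 3 [:: 1; 1]%R); last exact: oner_neq0.
by rewrite !big_ord_recl big_ord0 /coef /= !expr1n expr0n /= !addr0.
Qed.
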